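(* Let $R$ be a ring, $\sigma$ an endomorphism of $R$, $M_R$ a right $R$-module, and $n\geq 2$ any integer. Then $M_R$ is $\sigma$-skew McCoy if and only if $V_n(M,\sigma)$ is $\overline{\sigma}$-skew McCoy as a right $V_n(R,\sigma)$-module.
   Context: Rings are associative with unity; modules are right modules. For an endomorphism $\sigma$ of a ring $R$, $R[x;\sigma]$ is the skew polynomial ring of polynomials $\sum a_ix^i$ with coefficients on the left and $xa=\sigma(a)x$ for $a\in R$. For a right $R$-module $M$, $M[x;\sigma]=\{\sum_{i=0}^p m_ix^i\mid p\ge 0,\ m_i\in M\}$ is the right $R[x;\sigma]$-module with obvious addition and action $(mx^j)(ax^{\ell})=m\sigma^j(a)x^{j+\ell}$. $M_R$ is called $\sigma$-skew McCoy if whenever $m(x)g(x)=0$ with $m(x)\in M[x;\sigma]$ and $g(x)\in R[x;\sigma]\setminus\{0\}$, there exists $a\in R\setminus\{0\}$ with $m(x)a=0$. $V_n(R,\sigma)$ (skew triangular matrix ring) is the set of $n\times n$ upper triangular matrices that are constant along diagonals, with entries in $R$; such a matrix is determined by its first row and is denoted $(a_0,a_1,\dots,a_{n-1})$, $a_i\in R$. Likewise $V_n(M,\sigma)$ is the set of such matrices $(m_0,m_1,\dots,m_{n-1})$ with $m_i\in M$. Addition is the usual matrix addition. The right action of $V_n(R,\sigma)$ on $V_n(M,\sigma)$ is $(m_0,\dots,m_{n-1})(a_0,\dots,a_{n-1})=(c_0,\dots,c_{n-1})$ with $c_i=m_0\sigma^0(a_i)+m_1\sigma^1(a_{i-1})+\cdots+m_i\sigma^i(a_0)$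 for $0\le i\le n-1$, and the multiplication of the ring $V_n(R,\sigma)$ is given by the same formula with $M=R$. The endomorphism $\overline{\sigma}$ of $V_n(R,\sigma)$ is $\overline{\sigma}((a_0,\dots,a_{n-1}))=(\sigma(a_0),\dots,\sigma(a_{n-1}))$. *)

(* Defs.v *)
From HB Require Import structures.
From mathcomp Require Import all_boot all_order all_algebra finmap.
From mathcomp.multinomials Require Import monalg.

Set Implicit Arguments.
Unset Strict Implicit.
Unset Printing Implicit Defensive.

Import GRing.Theory.
Local Open Scope ring_scope.

Reserved Notation "m *> a" (at level 40, left associativity).

(* Right R-modules are left modules over the opposite ring R^c. *)
Definition rscale (R : pzRingType) (M : lmodType R^c) (m : M) (a : R) : M :=
  (a : R^c) *: m.

Notation "m *> a" := (rscale m a) : ring_scope.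

Section RightScale.

Variables (R : pzRingType) (M : lmodType R^c).

Lemma rscaleA (m : M) (a b : R) : m *> a *> b = m *> (a * b).
Proof. exact: scalerA. Qed.

Lemma rscale1 (m : M) : m *> (1 : R) = m.
Proof. exact: scale1r. Qed.

Lemma rscaleDl (m1 m2 : M) (a : R) : (m1 + m2) *> a = m1 *> a + m2 *> a.
Proof. exact: scalerDr. Qed.

Lemma rscaleDr (m : M) (a b : R) : m *> (a + b) = m *> a + m *> b.
Proof. exact: scalerDl. Qed.

End RightScale.

(* The products of R[x;sigma] and V_n(R,sigma), and their actions on          *)
(* M[x;sigma] and V_n(M,sigma), are all given by one formula, parameterized   *)
(* here by a biadditive op : A -> R -> A, which is either the multiplication  *)
(* of R (A = R) or the right action of R on M (A = M).                        *)
Section SkewProducts.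

Variables (R : pzRingType) (sigma : {rmorphism R -> R}) (A : zmodType).
Variable op : A -> R -> A.

Definition skew_conv (m : nat -> A) (a : nat -> R) (i : nat) : A :=
  \sum_(j < i.+1) op (m j) (iter j sigma (a (i - j)%N)).

(* (m x^i) (a x^j) = m sigma^i(a) x^(i+j), extended biadditively (see         *)
(* skew_mulpUU). An element g of {malg A[nat]}, i.e. a finitely supported     *)
(* function nat -> A, is the finite sum of the terms << g@_i *g i >>, each    *)
(* standing for g_i x^i.                                                      *)
Definition skew_mulp (m : {malg A[nat]}) (g : {malg R[nat]}) : {malg A[nat]} :=
  \sum_(i <- msupp m) \sum_(j <- msupp g)
     << op m@_i (iter i sigma g@_j) *g (i + j)%N >>.

Lemma iter_sigma0 k : iter k sigma 0 = 0.
Proof. by elim: k => //= k ->; rewrite rmorph0. Qed.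

Lemma iter_sigma1 k : iter k sigma 1 = 1.
Proof. by elim: k => //= k ->; rewrite rmorph1. Qed.

Lemma iter_sigmaD k a b :
  iter k sigma (a + b) = iter k sigma a + iter k sigma b.
Proof. by elim: k => //= k ->; rewrite rmorphD. Qed.

Lemma iter_sigmaM k a b :
  iter k sigma (a * b) = iter k sigma a * iter k sigma b.
Proof. by elim: k => //= k ->; rewrite rmorphM. Qed.

Lemma iter_sigma_sum k (I : Type) (r : seq I) (P : pred I) (F : I -> R) :
  iter k sigma (\sum_(i <- r | P i) F i) =
  \sum_(i <- r | P i) iter k sigma (F i).
Proof.
by apply: (big_morph (iter k sigma)) => [a b|];
  rewrite ?iter_sigmaD ?iter_sigma0.
Qed.

Lemma eq_skew_conv m m' a a' i :
    (forall j, (j <= i)%N -> m j = m' j) ->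
    (forall j, (j <= i)%N -> a j = a' j) ->
  skew_conv m a i = skew_conv m' a' i.
Proof.
move=> em ea; apply: eq_bigr => j _.
by rewrite em ?ea ?leq_subr // -ltnS ltn_ord.
Qed.

Context (opDl : forall m1 m2 a, op (m1 + m2) a = op m1 a + op m2 a).
Context (opDr : forall m a b, op m (a + b) = op m a + op m b).

Lemma op0l a : op 0 a = 0.
Proof. by apply: (addrI (op 0 a)); rewrite -opDl !addr0. Qed.

Lemma op0r m : op m 0 = 0.
Proof. by apply: (addrI (op m 0)); rewrite -opDr !addr0. Qed.

Lemma op_suml (I : Type) (r : seq I) (P : pred I) (F : I -> A) a :
  op (\sum_(i <- r | P i) F i) a = \sum_(i <- r | P i) op (F i) a.
Proof. by apply: (big_morph (op^~ a)) => [x y|]; rewrite ?opDl ?op0l. Qed.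

Lemma op_sumr (I : Type) (r : seq I) (P : pred I) (F : I -> R) m :
  op m (\sum_(i <- r | P i) F i) = \sum_(i <- r | P i) op m (F i).
Proof. by apply: (big_morph (op m)) => [x y|]; rewrite ?opDr ?op0r. Qed.

Lemma skew_convDl m1 m2 a i :
  skew_conv (fun j => m1 j + m2 j) a i = skew_conv m1 a i + skew_conv m2 a i.
Proof. by rewrite -big_split; apply: eq_bigr => j _; rewrite opDl. Qed.

Lemma skew_convDr m a b i :
  skew_conv m (fun j => a j + b j) i = skew_conv m a i + skew_conv m b i.
Proof.
by rewrite -big_split; apply: eq_bigr => j _; rewrite iter_sigmaD opDr.
Qed.

Lemma skew_mulpE m g k :
  (skew_mulp m g)@_k = skew_conv (mcoeff^~ m) (mcoeff^~ g) k.
Proof.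
have inner i : (\sum_(j <- msupp g)
      << op m@_i (iter i sigma g@_j) *g (i + j)%N >>)@_k =
    if (i <= k)%N then op m@_i (iter i sigma g@_(k - i)%N) else 0.
  rewrite raddf_sum /=; case: leqP => [leik|ltki]; last first.
    rewrite big1 // => j _; rewrite mcoeffU; case: eqP => // e.
    by move: ltki; rewrite -e ltnNge leq_addr.
  case: (msuppP g (k - i)%N) => [kg|kg].
    rewrite (big_fsetD1 (k - i)%N) //= subnKC // mcoeffUU big1_fset ?addr0 //.
    move=> j; rewrite in_fsetD1 => /andP[jk _] _.
    rewrite mcoeffU; case: eqP => // e.
    by case/eqP: jk; rewrite -e addKn.
  rewrite iter_sigma0 op0r big1_fset // => j jg _.
  rewrite mcoeffU; case: eqP => // e.
  by case/negP: kg; rewrite -e addKn.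
rewrite /skew_mulp raddf_sum /=; under eq_bigr do rewrite inner.
pose F i := if (i <= k)%N then op m@_i (iter i sigma g@_(k - i)%N) else 0.
have -> : skew_conv (mcoeff^~ m) (mcoeff^~ g) k = \sum_(i <- iota 0 k.+1) F i.
  rewrite /skew_conv -(big_mkord xpredT
    (fun j => op m@_j (iter j sigma g@_(k - j)%N))) /index_iota subn0.
  apply: eq_big_seq => i; rewrite mem_iota add0n ltnS /= => leik.
  by rewrite /F leik.
rewrite [RHS](bigID (fun i => i \in msupp m)) /=.
rewrite [X in _ = _ + X]big1 ?addr0; last first.
  by move=> i /mcoeff_outdom mi0; rewrite /F mi0 op0l if_same.
rewrite [LHS](bigID (fun i => i <= k)%N) /= [X in _ + X]big1 ?addr0; last first.
  by move=> i /negbTE; rewrite /F => ->.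
rewrite -big_filter -[RHS]big_filter; apply: perm_big.
apply: uniq_perm => [||i].
- exact/filter_uniq/fset_uniq.
- exact/filter_uniq/(iota_uniq 0 k.+1).
by rewrite !mem_filter (mem_iota 0 k.+1) add0n ltnS /= andbC.
Qed.

Lemma skew_mulpUU m i a j :
  skew_mulp << m *g i >> << a *g j >> =
  << op m (iter i sigma a) *g (i + j)%N >>.
Proof.
rewrite /skew_mulp !msuppU.
have [->|_] := eqVneq m 0; first by rewrite big_seq_fset0 op0l monalgU0.
rewrite big_seq_fset1; have [->|_] := eqVneq a 0.
  by rewrite big_seq_fset0 iter_sigma0 op0r monalgU0.
by rewrite big_seq_fset1 !mcoeffUU.
Qed.

Lemma skew_conv1 m : (forall k, op k 1 = k) ->
  forall i, skew_conv m (fun j => (j == 0%N)%:R) i = m i.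
Proof.
move=> op1 i; rewrite /skew_conv big_ord_recr /= subnn iter_sigma1 op1.
rewrite big1 ?add0r // => j _.
by rewrite subn_eq0 leqNgt ltn_ord /= iter_sigma0 op0r.
Qed.

End SkewProducts.

Section SkewProductAssoc.

Variables (R : pzRingType) (sigma : {rmorphism R -> R}) (A : zmodType).
Variable op : A -> R -> A.
Context (opDl : forall m1 m2 a, op (m1 + m2) a = op m1 a + op m2 a).
Context (opDr : forall m a b, op m (a + b) = op m a + op m b).
Context (opA : forall m a b, op (op m a) b = op m (a * b)).

Lemma skew_convA m a b i :
  skew_conv sigma op (skew_conv sigma op m a) b i =
  skew_conv sigma op m (skew_conv sigma *%R a b) i.
Proof.
pose F j k := op (m j) (iter j sigma (a (k - j)%N) *
                        iter k sigma (b (i - k)%N)).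
transitivity (\sum_(k < i.+1) \sum_(j < i.+1 | (j <= k)%N) F j k).
  apply: eq_bigr => k _; rewrite op_suml //.
  rewrite (big_ord_narrow_leq (ltn_ord k : (k <= i)%N)) /=.
  by apply: eq_bigr => j _; rewrite opA.
transitivity (\sum_(j < i.+1) \sum_(k < i.+1 | (j <= k)%N) F j k).
  by rewrite (exchange_big_dep xpredT).
apply: eq_bigr => j _; rewrite /skew_conv iter_sigma_sum op_sumr //.
rewrite -(big_mkord (fun k => j <= k)%N (F j)).
have leji : (j <= i.+1)%N by rewrite ltnW.
rewrite (big_cat_nat (leq0n j) leji) //= big_nat_cond big_pred0 ?add0r; last first.
  by move=> k; case: (leqP j k).
rewrite -{1}[nat_of_ord j]add0n big_addn subSn -1?ltnS // big_mkord.
apply: eq_big => [k|k _]; first by rewrite leq_addl.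
rewrite /F addnK iter_sigmaM -iterD [(j + k)%N]addnC.
by rewrite [(k + j)%N]addnC subnDA.
Qed.

End SkewProductAssoc.

Lemma skew_conv_1l (R : pzRingType) (sigma : {rmorphism R -> R})
    (a : nat -> R) i :
  skew_conv sigma *%R (fun j => (j == 0%N)%:R) a i = a i.
Proof.
rewrite /skew_conv big_ord_recl /= subn0 mul1r big1 ?addr0 // => j _.
by rewrite mul0r.
Qed.

Section SkewPolynomials.

Variables (R : pzRingType) (sigma : {rmorphism R -> R}).

(* R[x;sigma]; the phantom argument sigma determines the multiplication. *)
Definition skewpoly of {rmorphism R -> R} : Type := {malg R[nat]}.

HB.instance Definition _ := GRing.Zmodule.copy (skewpoly sigma) {malg R[nat]}.

Definition skewpolyC (a : R) : skewpoly sigma := << a *g 0%N >>.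

Definition skewpoly_mul (g h : skewpoly sigma) : skewpoly sigma :=
  skew_mulp sigma *%R g h.

Lemma skewpoly_mulE (g h : skewpoly sigma) k :
  (skewpoly_mul g h)@_k = skew_conv sigma *%R (mcoeff^~ g) (mcoeff^~ h) k.
Proof. by rewrite skew_mulpE //; [exact: mulrDl | exact: mulrDr]. Qed.

Lemma skewpolyC1E k : (skewpolyC 1)@_k = (k == 0%N)%:R.
Proof. by rewrite mcoeffU eq_sym. Qed.

Fact skewpoly_mulA : associative skewpoly_mul.
Proof.
move=> f g h; apply/malgP => k; rewrite !skewpoly_mulE; symmetry.
rewrite [LHS](eq_skew_conv _ _ (fun j _ => skewpoly_mulE f g j)
  (fun j _ => erefl h@_j)).
rewrite [RHS](eq_skew_conv _ _ (fun j _ => erefl f@_j)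
  (fun j _ => skewpoly_mulE g h j)).
by apply: skew_convA => *; rewrite ?mulrDl ?mulrDr ?mulrA.
Qed.

Fact skewpoly_mul1p : left_id (skewpolyC 1) skewpoly_mul.
Proof.
move=> g; apply/malgP => k; rewrite skewpoly_mulE.
rewrite (eq_skew_conv _ _ (fun j _ => skewpolyC1E j) (fun j _ => erefl g@_j)).
exact: skew_conv_1l.
Qed.

Fact skewpoly_mulp1 : right_id (skewpolyC 1) skewpoly_mul.
Proof.
move=> g; apply/malgP => k; rewrite skewpoly_mulE.
rewrite (eq_skew_conv _ _ (fun j _ => erefl g@_j) (fun j _ => skewpolyC1E j)).
by apply: skew_conv1 => *; rewrite ?mulrDl ?mulrDr ?mulr1.
Qed.

Fact skewpoly_mulDl : left_distributive skewpoly_mul +%R.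
Proof.
move=> f g h; apply/malgP => k; rewrite mcoeffD !skewpoly_mulE.
rewrite -skew_convDl; last exact: mulrDl.
by apply: eq_skew_conv => // j _; rewrite mcoeffD.
Qed.

Fact skewpoly_mulDr : right_distributive skewpoly_mul +%R.
Proof.
move=> f g h; apply/malgP => k; rewrite mcoeffD !skewpoly_mulE.
rewrite -skew_convDr; last exact: mulrDr.
by apply: eq_skew_conv => // j _; rewrite mcoeffD.
Qed.

HB.instance Definition _ := GRing.Zmodule_isPzRing.Build (skewpoly sigma)
  skewpoly_mulA skewpoly_mul1p skewpoly_mulp1 skewpoly_mulDl skewpoly_mulDr.

Variable M : lmodType R^c.

(* M[x;sigma] *)
Definition skewpolym of {rmorphism R -> R} : Type := {malg M[nat]}.

HB.instance Definition _ := GRing.Zmodule.copy (skewpolym sigma) {malg M[nat]}.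

Definition skewpolym_act (g : (skewpoly sigma)^c) (m : skewpolym sigma) :
  skewpolym sigma := skew_mulp sigma (@rscale R M) m g.

Lemma skewpolym_actE (m : skewpolym sigma) (g : skewpoly sigma) k :
  (skewpolym_act g m)@_k =
  skew_conv sigma (@rscale R M) (mcoeff^~ m) (mcoeff^~ g) k.
Proof. by rewrite skew_mulpE // => *; rewrite ?rscaleDl ?rscaleDr. Qed.

Fact skewpolym_actA (g h : (skewpoly sigma)^c) (m : skewpolym sigma) :
  skewpolym_act g (skewpolym_act h m) = skewpolym_act (g * h) m.
Proof.
apply/malgP => k; rewrite !skewpolym_actE.
rewrite [LHS](eq_skew_conv _ _ (fun j _ => skewpolym_actE m h j)
  (fun j _ => erefl (mcoeff j (g : skewpoly sigma)))).
rewrite [RHS](eq_skew_conv _ _ (fun j _ => erefl m@_j)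
  (fun j _ => skewpoly_mulE h g j)).
by apply: skew_convA => *; rewrite ?rscaleDl ?rscaleDr ?rscaleA.
Qed.

Fact skewpolym_act1 : left_id 1 skewpolym_act.
Proof.
move=> m; apply/malgP => k; rewrite skewpolym_actE.
rewrite (eq_skew_conv _ _ (fun j _ => erefl m@_j) (fun j _ => skewpolyC1E j)).
by apply: skew_conv1 => *; rewrite ?rscaleDl ?rscaleDr ?rscale1.
Qed.

Fact skewpolym_actDr : right_distributive skewpolym_act +%R.
Proof.
move=> g m1 m2; apply/malgP => k; rewrite mcoeffD !skewpolym_actE.
rewrite -skew_convDl; last by move=> *; rewrite rscaleDl.
by apply: eq_skew_conv => // j _; rewrite mcoeffD.
Qed.

Fact skewpolym_actDl (m : skewpolym sigma) :
  {morph skewpolym_act^~ m : g h / g + h}.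
Proof.
move=> g h; apply/malgP => k; rewrite mcoeffD !skewpolym_actE.
rewrite -skew_convDr; last by move=> *; rewrite rscaleDr.
by apply: eq_skew_conv => // j _; rewrite mcoeffD.
Qed.

HB.instance Definition _ :=
  GRing.Zmodule_isLmodule.Build (skewpoly sigma)^c (skewpolym sigma)
    skewpolym_actA skewpolym_act1 skewpolym_actDr skewpolym_actDl.

End SkewPolynomials.

Arguments skewpolym {R} M _.

Definition skew_McCoy (R : pzRingType) (sigma : {rmorphism R -> R})
    (M : lmodType R^c) : Prop :=
  forall (m : skewpolym M sigma) (g : skewpoly sigma),
    m *> g = 0 -> g != 0 ->
  exists2 a : R, a != 0 & m *> skewpolyC sigma a = 0.

Section TriToeplitz.

Variables (n : nat) (A : zmodType).

(* Upper triangular and constant along diagonals. *)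
Definition is_tritoep : {pred 'M[A]_n} := fun B =>
  [forall i : 'I_n, forall j : 'I_n, (j < i)%N ==> (B i j == 0)] &&
  [forall i : 'I_n, forall j : 'I_n, forall i' : 'I_n, forall j' : 'I_n,
     (j + i' == j' + i)%N ==> (B i j == B i' j')].

Record tritoep : predArgType := TriToep {
  tritoep_mx :> 'M[A]_n;
  tritoepP : tritoep_mx \in is_tritoep
}.

HB.instance Definition _ := [isSub for tritoep_mx].
HB.instance Definition _ := [Choice of tritoep by <:].

Lemma is_tritoepP (B : 'M[A]_n) :
  reflect ((forall i j : 'I_n, (j < i)%N -> B i j = 0) /\
           (forall i j i' j' : 'I_n, (j + i' = j' + i)%N -> B i j = B i' j'))
          (B \in is_tritoep).
Proof.
apply: (iffP andP) => [[/forallP tB /forallP dB]|[tB dB]]; split.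
- by move=> i j ltji; move/forallP/(_ j)/implyP/(_ ltji)/eqP: (tB i).
- move=> i j i' j' /eqP e.
  by move: (dB i) => /forallP/(_ j)/forallP/(_ i')/forallP/(_ j')/implyP/(_ e)/eqP.
- by apply/forallP => i; apply/forallP => j; apply/implyP => /tB/eqP.
- do 4![apply/forallP => ?]; by apply/implyP => /eqP/dB/eqP.
Qed.

Fact is_tritoep_zmod_closed : zmod_closed is_tritoep.
Proof.
split=> [|B C /is_tritoepP[tB dB] /is_tritoepP[tC dC]]; apply/is_tritoepP.
  by split=> *; rewrite !mxE.
split=> [i j ltji|i j i' j' e]; rewrite !mxE; first by rewrite tB ?tC ?subr0.
by rewrite (dB _ _ _ _ e) (dC _ _ _ _ e).
Qed.

HB.instance Definition _ :=
  GRing.isZmodClosed.Build 'M[A]_n is_tritoep is_tritoep_zmod_closed.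
HB.instance Definition _ := [SubChoice_isSubZmodule of tritoep by <:].

(* The matrix (a_0, a_1, ..., a_(n-1)); the values a_k with k >= n are junk. *)
Definition tritoep_mx_of (a : nat -> A) : 'M[A]_n :=
  \matrix_(i, j) (if (i <= j)%N then a (j - i)%N else 0).

Fact tritoep_of_subproof a : tritoep_mx_of a \in is_tritoep.
Proof.
apply/is_tritoepP; split=> [i j ltji|i j i' j' e]; rewrite !mxE.
  by rewrite leqNgt ltji.
have -> : (i' <= j')%N = (i <= j)%N.
  by rewrite -(leq_add2r i) -e addnC leq_add2r.
case: leqP => // leij; congr a.
have lej : (i' <= j')%N by rewrite -(leq_add2r i) -e addnC leq_add2r.
by apply: (@addIn (i + i')%N); rewrite addnA subnK // e [in RHS]addnCA
  [in RHS]subnK 1?addnC.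
Qed.

Definition tritoep_of (a : nat -> A) : tritoep := TriToep (tritoep_of_subproof a).

(* The entry k of the first row, extended by 0 to all natural numbers. *)
Definition tritoep_coef (B : tritoep) (k : nat) : A :=
  if (insub k : option 'I_n) is Some j
  then B (Ordinal (leq_ltn_trans (leq0n j) (ltn_ord j))) j else 0.

Lemma tritoep_ofK a k : (k < n)%N -> tritoep_coef (tritoep_of a) k = a k.
Proof.
by move=> ltkn; rewrite /tritoep_coef insubT /= mxE /= subn0.
Qed.

Lemma tritoep_coef_out B k : (n <= k)%N -> tritoep_coef B k = 0.
Proof. by move=> lenk; rewrite /tritoep_coef insubF // ltnNge lenk. Qed.

Lemma tritoep_entryE (B : tritoep) (i j : 'I_n) :
  B i j = if (i <= j)%N then tritoep_coef B (j - i)%N else 0.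
Proof.
have /is_tritoepP[tB dB] := tritoepP B.
case: leqP => [leij|/tB //]; rewrite /tritoep_coef.
have ltn' : (j - i < n)%N by rewrite (leq_ltn_trans (leq_subr _ _)).
by rewrite insubT /=; apply: dB; rewrite /= addn0 subnK.
Qed.

Lemma tritoep_coefK (B : tritoep) : tritoep_of (tritoep_coef B) = B.
Proof.
by apply/val_inj/matrixP => i j; rewrite mxE /= -tritoep_entryE.
Qed.

Lemma tritoep_coefP (B C : tritoep) :
  (forall k, (k < n)%N -> tritoep_coef B k = tritoep_coef C k) -> B = C.
Proof.
move=> eBC; apply/val_inj/matrixP => i j; rewrite /= !tritoep_entryE.
by case: leqP => // _; rewrite eBC // (leq_ltn_trans (leq_subr _ _)).
Qed.

Lemma tritoep_coef0 k : tritoep_coef 0 k = 0.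
Proof. by rewrite /tritoep_coef; case: insub => // j; rewrite mxE. Qed.

Lemma tritoep_coefD B C k :
  tritoep_coef (B + C) k = tritoep_coef B k + tritoep_coef C k.
Proof.
by rewrite /tritoep_coef; case: insub => [j|]; rewrite ?addr0 //= mxE.
Qed.

Lemma tritoep_coefB B C k :
  tritoep_coef (B - C) k = tritoep_coef B k - tritoep_coef C k.
Proof.
by rewrite /tritoep_coef; case: insub => [j|]; rewrite ?subr0 //= !mxE.
Qed.

End TriToeplitz.

Section SkewTriangular.

Variables (n : nat) (R : pzRingType) (sigma : {rmorphism R -> R}).

(* V_n(R,sigma) *)
Definition skewtri of {rmorphism R -> R} : Type := tritoep n R.

HB.instance Definition _ := GRing.Zmodule.copy (skewtri sigma) (tritoep n R).

Definition skewtri_one : skewtri sigma := tritoep_of n (fun k => (k == 0%N)%:R).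

Definition skewtri_mul (a b : skewtri sigma) : skewtri sigma :=
  tritoep_of n (skew_conv sigma *%R (tritoep_coef a) (tritoep_coef b)).

Lemma skewtri_mx_one : tritoep_mx skewtri_one = 1%:M.
Proof.
apply/matrixP => i j; rewrite !mxE -val_eqE /= subn_eq0 eqn_leq.
by case: leqP.
Qed.

Lemma skewtri_mulE (a b : skewtri sigma) k : (k < n)%N ->
  tritoep_coef (skewtri_mul a b) k =
  skew_conv sigma *%R (tritoep_coef a) (tritoep_coef b) k.
Proof. exact: tritoep_ofK. Qed.

Lemma skewtri_oneE k : (k < n)%N -> tritoep_coef skewtri_one k = (k == 0%N)%:R.
Proof. exact: tritoep_ofK. Qed.

Fact skewtri_mulA : associative skewtri_mul.
Proof.
move=> a b c; apply: tritoep_coefP => k ltkn; rewrite !skewtri_mulE //.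
symmetry.
rewrite [LHS](eq_skew_conv _ _
  (fun j lejk => skewtri_mulE a b (leq_ltn_trans lejk ltkn))
  (fun j _ => erefl (tritoep_coef c j))).
rewrite [RHS](eq_skew_conv _ _ (fun j _ => erefl (tritoep_coef a j))
  (fun j lejk => skewtri_mulE b c (leq_ltn_trans lejk ltkn))).
by apply: skew_convA => *; rewrite ?mulrDl ?mulrDr ?mulrA.
Qed.

Fact skewtri_mul1p : left_id skewtri_one skewtri_mul.
Proof.
move=> a; apply: tritoep_coefP => k ltkn; rewrite skewtri_mulE //.
rewrite (eq_skew_conv _ _ (fun j lejk => skewtri_oneE (leq_ltn_trans lejk ltkn))
  (fun j _ => erefl (tritoep_coef a j))).
exact: skew_conv_1l.
Qed.

Fact skewtri_mulp1 : right_id skewtri_one skewtri_mul.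
Proof.
move=> a; apply: tritoep_coefP => k ltkn; rewrite skewtri_mulE //.
rewrite (eq_skew_conv _ _ (fun j _ => erefl (tritoep_coef a j))
  (fun j lejk => skewtri_oneE (leq_ltn_trans lejk ltkn))).
by apply: skew_conv1 => *; rewrite ?mulrDl ?mulrDr ?mulr1.
Qed.

Fact skewtri_mulDl : left_distributive skewtri_mul +%R.
Proof.
move=> a b c; apply: tritoep_coefP => k ltkn.
rewrite tritoep_coefD !skewtri_mulE // -skew_convDl; last exact: mulrDl.
by apply: eq_skew_conv => // j _; rewrite tritoep_coefD.
Qed.

Fact skewtri_mulDr : right_distributive skewtri_mul +%R.
Proof.
move=> a b c; apply: tritoep_coefP => k ltkn.
rewrite tritoep_coefD !skewtri_mulE // -skew_convDr; last exact: mulrDr.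
by apply: eq_skew_conv => // j _; rewrite tritoep_coefD.
Qed.

HB.instance Definition _ := GRing.Zmodule_isPzRing.Build (skewtri sigma)
  skewtri_mulA skewtri_mul1p skewtri_mulp1 skewtri_mulDl skewtri_mulDr.

(* \overline{sigma} *)
Definition skewtri_map (a : skewtri sigma) : skewtri sigma :=
  tritoep_of n (fun k => sigma (tritoep_coef a k)).

Lemma skewtri_mx_map (a : skewtri sigma) :
  tritoep_mx (skewtri_map a) = map_mx sigma (tritoep_mx a).
Proof.
apply/matrixP => i j; rewrite !mxE tritoep_entryE.
by case: leqP; rewrite ?rmorph0.
Qed.

Lemma skewtri_mapE (a : skewtri sigma) k :
  tritoep_coef (skewtri_map a) k = sigma (tritoep_coef a k).
Proof.
case: (ltnP k n) => [ltkn|lenk]; first by rewrite tritoep_ofK.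
by rewrite !tritoep_coef_out ?rmorph0.
Qed.

Fact skewtri_map_is_zmod_morphism : zmod_morphism skewtri_map.
Proof.
move=> a b; apply: tritoep_coefP => k _.
by rewrite tritoep_coefB !skewtri_mapE tritoep_coefB rmorphB.
Qed.

Fact skewtri_map_is_monoid_morphism : monoid_morphism skewtri_map.
Proof.
split=> [|a b]; apply: tritoep_coefP => k ltkn; rewrite skewtri_mapE.
  by rewrite skewtri_oneE // rmorph_nat.
rewrite !skewtri_mulE // rmorph_sum; apply: eq_bigr => j _ /=.
by rewrite rmorphM !skewtri_mapE -iterS -iterSr.
Qed.

HB.instance Definition _ := GRing.isZmodMorphism.Build
  (skewtri sigma) (skewtri sigma) skewtri_map skewtri_map_is_zmod_morphism.
HB.instance Definition _ := GRing.isMonoidMorphism.Build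
  (skewtri sigma) (skewtri sigma) skewtri_map skewtri_map_is_monoid_morphism.

Variable M : lmodType R^c.

(* V_n(M,sigma) *)
Definition skewtrim of {rmorphism R -> R} : Type := tritoep n M.

HB.instance Definition _ := GRing.Zmodule.copy (skewtrim sigma) (tritoep n M).

Definition skewtrim_act (a : (skewtri sigma)^c) (m : skewtrim sigma) :
    skewtrim sigma :=
  tritoep_of n (skew_conv sigma (@rscale R M) (tritoep_coef m)
                  (tritoep_coef (a : skewtri sigma))).

Lemma skewtrim_actE (m : skewtrim sigma) (a : skewtri sigma) k : (k < n)%N ->
  tritoep_coef (skewtrim_act a m) k =
  skew_conv sigma (@rscale R M) (tritoep_coef m) (tritoep_coef a) k.
Proof. exact: tritoep_ofK. Qed.

Fact skewtrim_actA (a b : (skewtri sigma)^c) (m : skewtrim sigma) :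
  skewtrim_act a (skewtrim_act b m) = skewtrim_act (a * b) m.
Proof.
apply: tritoep_coefP => k ltkn; rewrite !skewtrim_actE //.
rewrite [LHS](eq_skew_conv _ _
  (fun j lejk => skewtrim_actE m b (leq_ltn_trans lejk ltkn))
  (fun j _ => erefl (tritoep_coef (a : skewtri sigma) j))).
rewrite [RHS](eq_skew_conv _ _ (fun j _ => erefl (tritoep_coef m j))
  (fun j lejk => skewtri_mulE b a (leq_ltn_trans lejk ltkn))).
by apply: skew_convA => *; rewrite ?rscaleDl ?rscaleDr ?rscaleA.
Qed.

Fact skewtrim_act1 : left_id 1 skewtrim_act.
Proof.
move=> m; apply: tritoep_coefP => k ltkn; rewrite skewtrim_actE //.
rewrite (eq_skew_conv _ _ (fun j _ => erefl (tritoep_coef m j))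
  (fun j lejk => skewtri_oneE (leq_ltn_trans lejk ltkn))).
by apply: skew_conv1 => *; rewrite ?rscaleDl ?rscaleDr ?rscale1.
Qed.

Fact skewtrim_actDr : right_distributive skewtrim_act +%R.
Proof.
move=> a m1 m2; apply: tritoep_coefP => k ltkn.
rewrite tritoep_coefD !skewtrim_actE // -skew_convDl; last first.
  by move=> *; rewrite rscaleDl.
by apply: eq_skew_conv => // j _; rewrite tritoep_coefD.
Qed.

Fact skewtrim_actDl (m : skewtrim sigma) :
  {morph skewtrim_act^~ m : a b / a + b}.
Proof.
move=> a b; apply: tritoep_coefP => k ltkn.
rewrite tritoep_coefD !skewtrim_actE // -skew_convDr; last first.
  by move=> *; rewrite rscaleDr.
by apply: eq_skew_conv => // j _; rewrite tritoep_coefD.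
Qed.

HB.instance Definition _ :=
  GRing.Zmodule_isLmodule.Build (skewtri sigma)^c (skewtrim sigma)
    skewtrim_actA skewtrim_act1 skewtrim_actDr skewtrim_actDl.

End SkewTriangular.

Arguments skewtrim n {R} M _.
Arguments skewtri_map n {R} sigma _.

(* Main.v *)
(** Put [y = (0, 1, 0, ..., 0)]. Then [V_n(R, sigma)] is [R[y; sigma] / (y^n)]
    and [x] commutes with [y], so polynomials over [V_n(M, sigma)] and
    [V_n(R, sigma)] are truncated series [m = \sum_l m_l(x) y^l] and
    [g = \sum_l g_l(x) y^l]. If [m g = 0] and [g_k] is the lowest nonzero
    component of [g], then [m_0 g_k = 0], and any nonzero [a] with [m_0 a = 0]
    gives [m (a y^(n-1)) = 0]. Conversely, [m(x) g(x) = 0] also holds over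
    [V_n], and if a nonzero [a = \sum_k a_k y^k] satisfies [m a = 0], then
    [m a_k = 0] for every [k]. *)

Require Import Defs.
From mathcomp Require Import all_boot all_order all_algebra.
From mathcomp.multinomials Require Import monalg.

Set Implicit Arguments.
Unset Strict Implicit.
Unset Printing Implicit Defensive.

Import GRing.Theory.
Local Open Scope ring_scope.

Section MapCoef.

Variables (A B : zmodType) (f : A -> B).

Definition malg_map (g : {malg A[nat]}) : {malg B[nat]} :=
  [malg i in msupp g => f g@_i].

(** Off the support of [g] the left side is 0 by construction, and [f0] makes the right side
    agree. *)
Lemma malg_mapE (f0 : f 0 = 0) (g : {malg A[nat]}) i : (malg_map g)@_i = f g@_i.
Proof. by rewrite mcoeffE; case: msuppP => // _; rewrite f0. Qed.

End MapCoef.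

Section RightAction.

Variables (R : pzRingType) (sigma : {rmorphism R -> R}) (M : lmodType R^c).

Lemma rscale0r (m : M) : m *> (0 : R) = 0.
Proof. exact: scale0r. Qed.

Lemma rscale0l (a : R) : (0 : M) *> a = 0.
Proof. exact: scaler0. Qed.

(** Serves both over [R] and over the triangular ring when the two actions are compared
    coefficientwise. *)
Lemma skewpolym_rscaleE (m : skewpolym M sigma) (g : skewpoly sigma) k :
  (m *> g)@_k = \sum_(j < k.+1) m@_(j : nat) *> iter j sigma g@_(k - j)%N.
Proof. exact: skewpolym_actE. Qed.

End RightAction.

Section SkewMcCoyTriangular.

Variables (R : pzRingType) (sigma : {rmorphism R -> R}) (M : lmodType R^c).

Section Components.

Variable n : nat.

Local Notation V := (skewtri n sigma).
Local Notation W := (skewtrim n M sigma).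
Local Notation Vsigma := (skewtri_map n sigma).

(** The component at [y^k], again a polynomial in [x]; a general [A] covers both [M] and [R]. *)
Definition tripoly_comp (A : zmodType) (k : nat) :=
  malg_map (fun B : tritoep n A => tritoep_coef B k).

Lemma tripoly_compE (A : zmodType) k (g : {malg (tritoep n A)[nat]}) i :
  (tripoly_comp k g)@_i = tritoep_coef g@_i k.
Proof. by rewrite malg_mapE // tritoep_coef0. Qed.

Lemma tripoly_compP (A : zmodType) (g h : {malg (tritoep n A)[nat]}) :
  (forall k, (k < n)%N -> tripoly_comp k g = tripoly_comp k h) -> g = h.
Proof.
move=> egh; apply/malgP => i; apply: tritoep_coefP => k /egh e.
by rewrite -!tripoly_compE e.
Qed.

Lemma tripoly_comp0 (A : zmodType) k :
  tripoly_comp k (0 : {malg (tritoep n A)[nat]}) = 0.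
Proof. by apply/malgP => i; rewrite tripoly_compE !mcoeff0 tritoep_coef0. Qed.

Lemma tripoly_compC k (a : V) :
  tripoly_comp k (skewpolyC Vsigma a) = skewpolyC sigma (tritoep_coef a k).
Proof.
apply/malgP => i; rewrite tripoly_compE !mcoeffU.
by case: eqP => // _; rewrite tritoep_coef0.
Qed.

Lemma tritoep_coef_sum (A : zmodType) k I (r : seq I) P (F : I -> tritoep n A) :
  tritoep_coef (\sum_(i <- r | P i) F i) k =
  \sum_(i <- r | P i) tritoep_coef (F i) k.
Proof.
by apply: (big_morph (fun B => tritoep_coef B k)) => [B C|];
  rewrite ?tritoep_coefD ?tritoep_coef0.
Qed.

Lemma tritoep_coef_iter j (a : V) k :
  tritoep_coef (iter j Vsigma a) k = iter j sigma (tritoep_coef a k).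
Proof. by elim: j => //= j <-; rewrite skewtri_mapE. Qed.

(* In degree [k] of [y], only the term [m_0 g_k] is left once the products
   [m_l sigma^l(g_(k-l))] with [l > 0] vanish. *)
Lemma tripoly_comp_rscale (m : skewpolym W Vsigma) (g : skewpoly Vsigma) k :
    (k < n)%N ->
    (forall j i l, (0 < l <= k)%N ->
       tritoep_coef m@_j l = 0 \/ tritoep_coef g@_i (k - l)%N = 0) ->
  tripoly_comp k (m *> g) =
  (tripoly_comp 0 m : skewpolym M sigma) *> (tripoly_comp k g : skewpoly sigma).
Proof.
move=> ltkn mg0; apply/malgP => i.
rewrite tripoly_compE skewpolym_rscaleE.
pose term (j : 'I_i.+1) : tritoep n M :=
  skewtrim_act (iter j Vsigma g@_(i - j)%N) m@_(j : nat).
have -> : tritoep_coef (m *> g)@_i k = tritoep_coef (\sum_j term j) k.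
  by congr tritoep_coef; apply: (skewpolym_rscaleE m g i).
rewrite tritoep_coef_sum.
apply: eq_bigr => j _; rewrite skewtrim_actE // /skew_conv big_ord_recl /=.
rewrite !tripoly_compE tritoep_coef_iter subn0 big1 ?addr0 // => l _.
(* With index 0 split off, [bump 0 l], that is [l + 1], runs over the powers of [y] at which [mg0]
   kills a factor. *)
have ltlk : (0 < bump 0 l <= k)%N by rewrite /= ltn_ord.
rewrite tritoep_coef_iter -iterS.
case: (mg0 j (i - j)%N _ ltlk) => /= ->; first exact: rscale0l.
by rewrite !iter_sigma0 rmorph0 rscale0r.
Qed.

Definition tritoep_const (A : zmodType) (a : A) : tritoep n A :=
  tritoep_of n (fun k => if k == 0%N then a else 0).

Lemma tritoep_constE (A : zmodType) (a : A) k :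
  (k < n)%N -> tritoep_coef (tritoep_const a) k = if k == 0%N then a else 0.
Proof. exact: tritoep_ofK. Qed.

Lemma tritoep_const0 (A : zmodType) : tritoep_const (0 : A) = 0.
Proof.
apply: tritoep_coefP => k ltkn.
by rewrite tritoep_constE // tritoep_coef0 if_same.
Qed.

Lemma tripoly_comp_const (A : zmodType) (g : {malg A[nat]}) k : (k < n)%N ->
  tripoly_comp k (malg_map (@tritoep_const A) g) = if k == 0%N then g else 0.
Proof.
move=> ltkn; apply/malgP => i; rewrite tripoly_compE malg_mapE.
  by rewrite tritoep_constE //; case: eqP; rewrite ?mcoeff0.
exact: tritoep_const0.
Qed.

Lemma skew_McCoy_tri : (0 < n)%N ->
  skew_McCoy sigma M -> skew_McCoy Vsigma W.
Proof.
move=> n_gt0 McM m g mg0 g_neq0.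
(* The components below [n] determine [g], so one of them is nonzero; take the lowest. *)
have [k k_gk k_min] : exists2 k, (k < n)%N && (tripoly_comp k g != 0) &
    forall l, (l < k)%N -> tripoly_comp l g = 0.
  have exk : exists k, (k < n)%N && (tripoly_comp k g != 0).
    have [k gk|no] := pickP (fun k : 'I_n => tripoly_comp k g != 0).
      by exists k; rewrite ltn_ord gk.
    case/eqP: g_neq0; apply: tripoly_compP => k ltkn; rewrite tripoly_comp0.
    by apply/eqP/negbFE/(no (Ordinal ltkn)).
  case: (ex_minnP exk) => k Pk kmin; exists k => // l ltlk.
  apply/eqP/negPn/negP => gl; case/andP: Pk => ltkn _.
  by have := kmin l; rewrite (ltn_trans ltlk ltkn) gl leqNgt ltlk => /(_ isT).
case/andP: k_gk => ltkn gk_neq0.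
have [|a a_neq0 m0a] := McM (tripoly_comp 0 m) (tripoly_comp k g) _ gk_neq0.
  rewrite -tripoly_comp_rscale //; first by rewrite mg0 tripoly_comp0.
  move=> j i l /andP[l_gt0 lelk]; right; rewrite -tripoly_compE k_min ?mcoeff0 //.
  by rewrite ltn_subrL l_gt0 (leq_trans l_gt0).
(* [b] is [a y^(n-1)]: any further factor [y] takes it to [y^n = 0], so only the component [m_0] of
   [m] can contribute to [m b]. *)
pose b : V := tritoep_of n (fun k => if k == n.-1 then a else 0).
have bE l : (l < n)%N -> tritoep_coef b l = if l == n.-1 then a else 0.
  exact: tritoep_ofK.
exists b.
  apply: contraNneq a_neq0 => b0.
  by rewrite -(tritoep_coef0 n R n.-1) -b0 bE ?eqxx // prednK.
apply: tripoly_compP => l ltln; rewrite tripoly_comp0 tripoly_comp_rscale //.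
  rewrite tripoly_compC bE //; case: eqP => // _.
  by rewrite /skewpolyC monalgU0 rscale0r.
(* Since [t > 0] and [l < n], the index [l - t] lies strictly below [n.-1], where [b] has entry
   0. *)
move=> j i t /andP[t_gt0 letl]; right.
have ltn1 : (l - t < n.-1)%N.
  rewrite -ltnS prednK // (leq_trans _ ltln) // ltnS.
  by rewrite ltn_subrL t_gt0 (leq_trans t_gt0).
rewrite mcoeffU; case: eqP => _; last by rewrite tritoep_coef0.
by rewrite /= bE ?ltn_eqF // (leq_trans ltn1) ?leq_pred.
Qed.

Lemma skew_McCoy_of_tri : (0 < n)%N ->
  skew_McCoy Vsigma W -> skew_McCoy sigma M.
Proof.
move=> n_gt0 McW m g mg0 g_neq0.
pose m' : skewpolym W Vsigma := malg_map (@tritoep_const M) m.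
pose g' : skewpoly Vsigma := malg_map (@tritoep_const R) g.
(* [m'] lives in degree 0 of [y], so it acts on each component of [h] separately. *)
have m'_comp (h : skewpoly Vsigma) k : (k < n)%N ->
    tripoly_comp k (m' *> h) = m *> (tripoly_comp k h : skewpoly sigma).
  move=> ltkn; rewrite tripoly_comp_rscale // => [|j i l /andP[l_gt0 lelk]].
    by rewrite tripoly_comp_const.
  left; rewrite -tripoly_compE tripoly_comp_const ?(leq_ltn_trans lelk) //.
  by rewrite gtn_eqF // mcoeff0.
have [||b b_neq0 m'b] := McW m' g'.
- apply: tripoly_compP => k ltkn; rewrite tripoly_comp0 m'_comp //.
  by rewrite tripoly_comp_const //; case: eqP => // _; rewrite rscale0r.
- apply: contraNneq g_neq0 => g'0.
  by have /= := tripoly_comp_const g n_gt0; rewrite -/g' g'0 tripoly_comp0 => <-.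
(* Any nonzero entry of [b] is a witness, because component [k] of [m' b] is [m b_k]. *)
have [k bk|b0] := pickP (fun k : 'I_n => tritoep_coef b k != 0).
  exists (tritoep_coef b k) => //.
  by rewrite -tripoly_compC -m'_comp // m'b tripoly_comp0.
case/eqP: b_neq0; apply: tritoep_coefP => k ltkn; rewrite tritoep_coef0.
by apply/eqP/negbFE/(b0 (Ordinal ltkn)).
Qed.

End Components.

End SkewMcCoyTriangular.

Theorem theorem3p4 (R : pzRingType) (sigma : {rmorphism R -> R})
    (M : lmodType R^c) (n : nat) (hn : (2 <= n)%N) :
  skew_McCoy sigma M <->
  @skew_McCoy (skewtri n sigma) (skewtri_map n sigma) (skewtrim n M sigma).
Proof.
have n_gt0 := ltnW hn.
by split; [exact: skew_McCoy_tri | exact: skew_McCoy_of_tri].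
Qed.
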